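(* Let $n$ be a positive integer and let $a \in \{1, \ldots, 2^n-1\}$. Let $A_a \subseteq \mathbb{Z}_2^n$ be the set of vectors in $\{0,1\}^n$ that are the binary representations of the numbers $2^n-1, 2^n-2, \ldots, 2^n-a$. Let $k$ be the unique integer satisfying $2^n - 2^k \le a < 2^n - 2^{k-1}$. Then for every $A \subseteq \mathbb{Z}_2^n$ with $a$ elements, $$\mathrm{ST}(A) \ge \mathrm{ST}(A_a) = (3a + 2^k - 2^{n+1})(2^n - 2^k).$$
   Context: For a subset $A$ of a finite abelian group, $\mathrm{ST}(A) = |\{(x,y,z) \in A^3 : x+y=z\}|$ is the number of (ordered) Schur triples contained in $A$ (elements not necessarily distinct). Elements of $\mathbb{Z}_2^n$ are identified with $\{0,1\}$-vectors of length $n$, and an integer in $\{0,\ldots,2^n-1\}$ with its $n$-digit binary representation. The integer $k$ may be $0$, in which case $2^{k-1} = 1/2$. *)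

(* Defs.v *)
From mathcomp Require Import all_boot all_order all_algebra.
Set Implicit Arguments.
Unset Strict Implicit.
Unset Printing Implicit Defensive.
Import GRing.Theory.
Local Open Scope ring_scope.

Definition ST (G : finZmodType) (A : {set G}) : nat :=
  #|[set t : G * G * G |
      [&& t.1.1 \in A, t.1.2 \in A, t.2 \in A & t.1.1 + t.1.2 == t.2]]|.

(* The most significant digit comes first: coordinate i holds the digit of
   weight 2 ^ (n - 1 - i). *)
Definition binary_vector (n m : nat) : 'rV['F_2]_n :=
  \row_(i < n) (odd (m %/ 2 ^ (n - i.+1)))%:R.

(* The index j < a gives the number 2 ^ n - (j + 1), so the numbers range over
   2 ^ n - 1, ..., 2 ^ n - a. *)
Definition top_set (n a : nat) : {set 'rV['F_2]_n} :=
  [set binary_vector n (2 ^ n - j.+1) | j : 'I_a].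

(* Main.v *)
Require Import Defs.
From mathcomp Require Import all_boot all_order all_algebra.
From mathcomp Require Import zify ring lra.
Set Implicit Arguments.
Unset Strict Implicit.
Unset Printing Implicit Defensive.
Import Order.TTheory GRing.Theory Num.Theory.
Local Open Scope ring_scope.

(** Write N = 2 ^ n, B for the complement of A and b = N - a for its size.
    Inclusion-exclusion gives ST A + ST B = a ^ 2 + b ^ 2 - a b
    ([ST_complement]), so minimising ST A over sets of size a amounts to
    maximising ST B over sets of size b. With K = 2 ^ k the power of two such
    that K / 2 < b <= K, the claim becomes

      ST B <= K ^ 2 - 3 b K + 3 b ^ 2   ([ST_upper]),

    with equality when B consists of the binary representations of 0, ..., b - 1
    ([ST_setC_top_set]). For equality, that B lies in the subspace S of size K
    of numbers below K, and the rest S \ B is sum-free, because all its elements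
    have their digit of weight K / 2 equal to 1; inclusion-exclusion inside S
    then gives the value.

    The upper bound goes by induction on b. Let L be the size of the span of B.

    - If L < 2 b, then L = K, and inclusion-exclusion inside the span gives the
      bound, since the number of Schur triples of the rest of the span is
      nonnegative.
    - Otherwise let H be the hyperplane through 0, among those not containing B,
      for which b0 = |B /\ H| is largest, and b1 = b - b0 > 0. A Schur triple
      has an even number of entries outside H, whence
      ST B <= ST (B /\ H) + 3 b1 ^ 2 ([ST_le_split]). Together with the
      induction hypothesis for B /\ H this suffices when b0 >= K / 2, and also
      when b1 <= K / 4.
    - In the remaining case b0 <= b - K / 4. Here N * ST B is the sum of the
      cubes of the Fourier coefficients of B; those of the characters that are
      nontrivial on B are at most b0 - b1, and the sum of all the squares is
      N b. As 2 b <= L, this yields ST B <= b * b0 ([ST_le_max]), and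
      b (b - K / 4) is below the required bound because the quadratic form
      2 b ^ 2 - 11 b Q + 16 Q ^ 2, Q = K / 4, has negative discriminant. *)

(** * Counting solutions of x + y = z with each variable in its own set *)

Lemma addvv n (x : 'rV['F_2]_n) : x + x = 0.
Proof. by rewrite -mulr2n -scaler_nat (_ : 2%:R = 0) ?scale0r //; apply/val_inj. Qed.

Lemma addvK n (x y : 'rV['F_2]_n) : x + y + y = x.
Proof. by rewrite -addrA addvv addr0. Qed.

Lemma addv_eq0 n (x y : 'rV['F_2]_n) : (x + y == 0) = (x == y).
Proof. by rewrite -(inj_eq (addIr y)) addvK add0r. Qed.

(** Mixed triples occur as soon as a set is cut into two parts; in
    characteristic two this count is symmetric in its three arguments. *)
Definition schur n (P Q R : {set 'rV['F_2]_n}) : nat :=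
  #|[set p : 'rV['F_2]_n * 'rV['F_2]_n |
      [&& p.1 \in P, p.2 \in Q & p.1 + p.2 \in R]]|.

Lemma ST_schur n (A : {set 'rV['F_2]_n}) : ST A = schur A A A.
Proof.
rewrite /ST /schur.
have inj : injective (fun p : 'rV['F_2]_n * 'rV['F_2]_n => (p, p.1 + p.2)).
  by move=> p q [].
rewrite -(card_imset _ inj); apply: eq_card => -[p z].
rewrite inE /=; apply/idP/imsetP => [/and4P[Ax Ay + /eqP zE]|[q]].
  rewrite -zE => Az.
  by exists p; rewrite // inE; apply/and3P.
by rewrite inE => /and3P[? ? ?] [-> ->]; apply/and4P.
Qed.

Lemma schurC n (P Q R : {set 'rV['F_2]_n}) : schur P Q R = schur Q P R.
Proof.
have inj : injective (fun p : 'rV['F_2]_n * 'rV['F_2]_n => (p.2, p.1)).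
  by move=> [? ?] [? ?] [-> ->].
rewrite /schur -(card_imset _ inj); apply: eq_card => -[x y].
rewrite inE /=; apply/imsetP/idP => [[[x' y']]|/and3P[? ? ?]].
  by rewrite inE /= => /and3P[? ? ?] [-> ->]; rewrite addrC; apply/and3P.
by exists (y, x) => //; rewrite inE /= addrC; apply/and3P.
Qed.

(** In characteristic two x + y = z is the same equation as z + y = x. *)
Lemma schur_rot n (P Q R : {set 'rV['F_2]_n}) : schur P Q R = schur R Q P.
Proof.
have inj : injective (fun p : 'rV['F_2]_n * 'rV['F_2]_n => (p.1 + p.2, p.2)).
  by move=> [x y] [x' y'] /= [e yE]; rewrite -yE in e *; rewrite (addIr _ e).
rewrite /schur -(card_imset _ inj); apply: eq_card => -[x y].
rewrite inE /=; apply/imsetP/idP => [[[x' y']]|/and3P[? ? ?]].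
  by rewrite inE /= => /and3P[? ? ?] [-> ->]; rewrite addvK; apply/and3P.
by exists (x + y, y); rewrite ?inE /= addvK //; apply/and3P.
Qed.

(** Only the first variable is split: the symmetries move any other variable
    there. *)
Lemma schur_split n (B P Q R : {set 'rV['F_2]_n}) :
  schur P Q R = (schur (P :&: B) Q R + schur (P :\: B) Q R)%N.
Proof.
rewrite /schur -(cardsID [set p | p.1 \in B]); congr (_ + _)%N;
  by apply: eq_card => p; rewrite !inE; case: (p.1 \in B); case: (p.1 \in P);
     rewrite ?andbT ?andbF.
Qed.

Lemma schur_le n (P Q R : {set 'rV['F_2]_n}) : (schur P Q R <= #|P| * #|Q|)%N.
Proof.
rewrite -cardsX; apply/subset_leq_card/subsetP => p.
by rewrite !inE => /and3P[-> ->].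
Qed.

Lemma schur_full n (P Q R : {set 'rV['F_2]_n}) :
  (forall x y, x \in P -> y \in Q -> x + y \in R) -> schur P Q R = (#|P| * #|Q|)%N.
Proof.
move=> PQR; rewrite -cardsX; apply: eq_card => p; rewrite !inE.
by apply/and3P/andP => [[]|[? ?]] //; split=> //; apply: PQR.
Qed.

Lemma schur_eq0 n (P Q R : {set 'rV['F_2]_n}) :
  (forall x y, x \in P -> y \in Q -> x + y \notin R) -> schur P Q R = 0%N.
Proof.
move=> PQR; apply: eq_card0 => p; rewrite !inE.
by apply/and3P => -[Pp Qp]; apply/negP/PQR.
Qed.

(** Inside a subspace S each of the counts with one variable ranging freely over
    S is a product of two cardinals; removing B from the three variables one at
    a time turns the count for the complement into minus the count for B. *)
Lemma ST_complement n (S B : {set 'rV['F_2]_n}) :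
    (forall x y, x \in S -> y \in S -> x + y \in S) -> B \subset S ->
  (ST B + ST (S :\: B) + #|B| * #|S :\: B| = #|B| ^ 2 + #|S :\: B| ^ 2)%N.
Proof.
move=> Sadd BS; set C := S :\: B.
have sS x : x \in B -> x \in S by move/(subsetP BS).
have sC x : x \in C -> x \in S by rewrite inE => /andP[].
have cap : S :&: B = B by apply/setIidPr.
rewrite !ST_schur.
have e1 := schur_split B S C C.
have e2 := schur_split B S B C.
have e3 := schur_split B S B B.
rewrite cap -/C in e1 e2 e3.
rewrite schur_rot schur_full in e1; last by move=> x y /sC ? /sC; apply: Sadd.
rewrite schur_rot schur_full in e2; last by move=> x y /sC ? /sS; apply: Sadd.
rewrite schur_rot schur_full in e3; last by move=> x y /sS ? /sS; apply: Sadd.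
have e4 : schur B C C = schur C B C by exact: schurC.
have e5 : schur B B C = schur C B B by exact: schur_rot.
nia.
Qed.

(** * Characters of the binary cube *)

Definition dot n (u x : 'rV['F_2]_n) : 'F_2 := \sum_i u 0 i * x 0 i.

Lemma dotC n (u x : 'rV['F_2]_n) : dot u x = dot x u.
Proof. by apply: eq_bigr => i _; rewrite mulrC. Qed.

Lemma dotDr n (u x y : 'rV['F_2]_n) : dot u (x + y) = dot u x + dot u y.
Proof. by rewrite -big_split; apply: eq_bigr => i _; rewrite mxE mulrDr. Qed.

Lemma dotDl n (u v x : 'rV['F_2]_n) : dot (u + v) x = dot u x + dot v x.
Proof. by rewrite dotC dotDr !(dotC x). Qed.

Lemma dotr0 n (u : 'rV['F_2]_n) : dot u 0 = 0.
Proof. by rewrite /dot big1 // => i _; rewrite mxE mulr0. Qed.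

Lemma dot_delta n (u : 'rV['F_2]_n) i : dot u (delta_mx 0 i) = u 0 i.
Proof.
rewrite /dot (bigD1 i) //= mxE !eqxx mulr1 big1 ?addr0 // => j ji.
by rewrite mxE (negPf ji) andbF mulr0.
Qed.

Lemma F2_neq0 (c : 'F_2) : (c != 0) = (c == 1).
Proof. by case: c => [[|[|]]]. Qed.

Definition sgn2 (c : 'F_2) : int := (-1) ^+ (c != 0).

Lemma sgn2D c d : sgn2 (c + d) = sgn2 c * sgn2 d.
Proof. by case: c => [[|[|//]] ?]; case: d => [[|[|//]] ?]. Qed.

Definition chi n (u x : 'rV['F_2]_n) : int := sgn2 (dot u x).

Lemma chiDr n (u x y : 'rV['F_2]_n) : chi u (x + y) = chi u x * chi u y.
Proof. by rewrite /chi dotDr sgn2D. Qed.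

(** perp W is the annihilator of W for [dot]; the span of B is obtained as
    perp (perp B). *)
Definition perp n (W : {set 'rV['F_2]_n}) : {set 'rV['F_2]_n} :=
  [set x | [forall u in W, dot u x == 0]].

Lemma perpP n (W : {set 'rV['F_2]_n}) x :
  reflect (forall u, u \in W -> dot u x = 0) (x \in perp W).
Proof.
by rewrite inE; apply: (iffP forall_inP) => h u /h => [/eqP|->].
Qed.

Lemma perpD n (W : {set 'rV['F_2]_n}) x y :
  x \in perp W -> y \in perp W -> x + y \in perp W.
Proof.
move=> /perpP Wx /perpP Wy; apply/perpP => u Wu.
by rewrite dotDr Wx // Wy // addr0.
Qed.

Lemma sub_perp_perp n (B : {set 'rV['F_2]_n}) : B \subset perp (perp B).
Proof.
apply/subsetP => x Bx; apply/perpP => u.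
by move/perpP => /(_ x Bx); rewrite dotC.
Qed.

Lemma perpT n : perp [set: 'rV['F_2]_n] = [set 0].
Proof.
apply/setP => x; rewrite in_set1; apply/perpP/eqP => [h|-> u _]; last exact: dotr0.
by apply/rowP => i; rewrite mxE -dot_delta dotC h // inE.
Qed.

(** If some u0 in W has dot u0 x = 1, then translating W by u0 pairs each term
    with its opposite. *)
Lemma sum_chi n (W : {set 'rV['F_2]_n}) (x : 'rV['F_2]_n) :
    (forall u v, u \in W -> v \in W -> u + v \in W) ->
  \sum_(u in W) chi u x = #|W|%:R * (x \in perp W)%:R.
Proof.
move=> Wadd; case: (boolP (x \in perp W)) => [/perpP Wx|].
  rewrite mulr1 (eq_bigr (fun=> 1)) => [|u Wu]; last by rewrite /chi Wx.
  by rewrite sumr_const.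
rewrite inE => /forall_inPn[u0 Wu0]; rewrite F2_neq0 => /eqP u0x.
rewrite mulr0; set s := \sum_(u in W) _.
suff : s = - s by lia.
rewrite {1}/s (reindex_inj (addIr u0)) /= -sumrN.
rewrite (eq_bigl (mem W)) => [|u]; first apply: eq_bigr => u _.
  by rewrite /chi dotDl sgn2D u0x mulrN1.
apply/idP/idP => [/Wadd/(_ Wu0)|Wu]; last exact: Wadd.
by rewrite addvK.
Qed.

Lemma mem_perp1 n (u x : 'rV['F_2]_n) : (x \in perp [set u]) = (dot u x == 0).
Proof. by apply/perpP/eqP => [->|h v /set1P ->] //; rewrite inE. Qed.

Lemma sum_chiT n (x : 'rV['F_2]_n) :
  \sum_u chi u x = (2 ^ n)%:R * (x == 0)%:R.
Proof.
have := @sum_chi n setT x; rewrite perpT in_set1 cardsT card_mx card_Fp // mul1n.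
by move=> <- => [|u v _ _]; [apply: eq_bigl => u|]; rewrite inE.
Qed.

(** Count the sum of chi u x over u in perp W and all x in both orders: summing
    over x first leaves only u = 0, summing over u first leaves only the x in
    perp (perp W). *)
Lemma card_perp n (W : {set 'rV['F_2]_n}) :
  (#|perp W| * #|perp (perp W)| = 2 ^ n)%N.
Proof.
apply/eqP; rewrite -eqz_nat PoszM -!natz; apply/eqP.
have <- : \sum_(u in perp W) \sum_x chi u x = (2 ^ n)%:R.
  under eq_bigr do under eq_bigr do rewrite /chi dotC.
  under eq_bigr do rewrite sum_chiT.
  rewrite -mulr_sumr (bigD1 0) /= ?eqxx; last by apply/perpP => u _; rewrite dotr0.
  by rewrite big1 ?addr0 ?mulr1 // => u /andP[_ /negPf ->].
rewrite exchange_big /= -[#|perp (perp _)|]sum1_card.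
rewrite natr_sum mulr_sumr [LHS]big_mkcond /=.
apply: eq_bigr => x _; rewrite sum_chi; last exact: perpD.
by case: ifP => _; rewrite ?mulr1 ?mulr0.
Qed.

(** * Fourier bounds for the number of Schur triples *)

Definition hat n (B : {set 'rV['F_2]_n}) (u : 'rV['F_2]_n) : int :=
  \sum_(x in B) chi u x.

(** Fourier inversion. *)
Lemma sum_chi_hat n (B : {set 'rV['F_2]_n}) (x : 'rV['F_2]_n) :
  \sum_u chi u x * hat B u = (2 ^ n)%:R * (x \in B)%:R.
Proof.
under eq_bigr do rewrite mulr_sumr.
rewrite exchange_big /=.
under eq_bigr do under eq_bigr do rewrite -chiDr.
under eq_bigr do rewrite sum_chiT addv_eq0.
rewrite -mulr_sumr; congr (_ * _); case: (boolP (x \in B)) => Bx.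
  by rewrite (bigD1 x) //= eqxx big1 ?addr0 // => y /andP[_ /negPf]; rewrite eq_sym => ->.
by rewrite big1 // => y By; case: eqP Bx => // ->; rewrite By.
Qed.

(** Parseval's identity. *)
Lemma sum_hat2 n (B : {set 'rV['F_2]_n}) :
  \sum_u hat B u ^+ 2 = (2 ^ n)%:R * #|B|%:R.
Proof.
under eq_bigr do rewrite expr2 {1}/hat mulr_suml.
rewrite exchange_big /= -[#|B|]sum1_card natr_sum mulr_sumr.
by apply: eq_bigr => x Bx; rewrite sum_chi_hat Bx.
Qed.

Lemma sum_hat3 n (B : {set 'rV['F_2]_n}) :
  \sum_u hat B u ^+ 3 = (2 ^ n)%:R * (ST B)%:R.
Proof.
have -> : (ST B)%:R = \sum_(x in B) \sum_(y in B) (x + y \in B)%:R :> int.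
  rewrite ST_schur /schur -sum1_card natr_sum pair_big_dep /=.
  rewrite [RHS](bigID (fun p => p.1 + p.2 \in B)) /= [X in _ + X]big1 ?addr0.
    apply: eq_big => [p|p]; first by rewrite inE andbA.
    by rewrite inE => /and3P[_ _ ->].
  by move=> p /andP[_ /negPf ->].
under eq_bigr do rewrite exprSr expr2 {1 2}/hat big_distrlr /= mulr_suml.
rewrite exchange_big mulr_sumr /=; apply: eq_bigr => x Bx.
under eq_bigr do rewrite mulr_suml.
rewrite exchange_big mulr_sumr /=; apply: eq_bigr => y By.
by under eq_bigr do rewrite -chiDr; rewrite sum_chi_hat.
Qed.

(** The character of u is 1 on the hyperplane perp [set u] and -1 off it. *)
Lemma hatE n (B : {set 'rV['F_2]_n}) u :
  hat B u = 2 * #|B :&: perp [set u]|%:R - #|B|%:R.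
Proof.
have sgnE x : chi u x = 2 * (x \in perp [set u])%:R - 1.
  by rewrite mem_perp1 /chi /sgn2; case: eqP.
rewrite /hat (eq_bigr _ (fun x _ => sgnE x)) sumrB sumr_const -mulr_sumr.
congr (2 * _ - _); rewrite -sum1_card natr_sum [LHS]big_mkcond [RHS]big_mkcond /=.
by apply: eq_bigr => x _; rewrite in_setI; case: (x \in B); case: (x \in perp _).
Qed.

Lemma hat_perp n (B : {set 'rV['F_2]_n}) u : u \in perp B -> hat B u = #|B|%:R.
Proof.
move=> /perpP Bu; rewrite /hat -sum1_card natr_sum; apply: eq_bigr => x Bx.
by rewrite /chi dotC Bu.
Qed.

(** In the sum of hat B u ^ 3 the terms with u in perp B are known exactly, and
    in each other term one factor is at most l = 2 m - |B|, while the remaining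
    squares are controlled by Parseval. With b, L for the sizes of B and of its
    span this reads L * ST B <= b ^ 3 + l (L b - b ^ 2), and the right-hand side
    is L b m minus the nonnegative quantity b (b - m) (L - 2 b). *)
Lemma ST_le_max n (B : {set 'rV['F_2]_n}) (m : nat) :
    (m <= #|B|)%N -> (2 * #|B| <= #|perp (perp B)|)%N ->
    (forall u, u \notin perp B -> (#|B :&: perp [set u]| <= m)%N) ->
  (ST B <= #|B| * m)%N.
Proof.
move=> mB BL max; have NE := card_perp B.
set M := #|perp B| in NE; set L := #|perp (perp B)| in NE BL; set b := #|B| in mB BL *.
have M0 : (0 < M)%N.
  by apply/card_gt0P; exists 0; apply/perpP => x _; rewrite dotr0.
pose l : int := 2 * m%:R - b%:R.
have sumU k : \sum_(u in perp B) hat B u ^+ k = M%:R * b%:R ^+ k.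
  rewrite (eq_bigr _ (fun u Bu => congr1 (fun c => c ^+ k) (hat_perp Bu))).
  by rewrite sumr_const -[LHS]mulr_natl.
have le3 : \sum_(u | u \notin perp B) hat B u ^+ 3 <=
           l * \sum_(u | u \notin perp B) hat B u ^+ 2.
  rewrite mulr_sumr; apply: ler_sum => u /max uB.
  by rewrite exprS ler_wpM2r ?sqr_ge0 // hatE lerD2r ler_pM2l ?ler_nat.
have := sum_hat2 B; have := sum_hat3 B.
rewrite (bigID (mem (perp B))) /= sumU => e3.
rewrite (bigID (mem (perp B))) /= sumU => e2.
rewrite -NE natrM -/b in e2 e3.
set S3 := \sum_(u | _) hat B u ^+ 3 in e3.
set S2 := \sum_(u | _) hat B u ^+ 2 in e2.
rewrite -/S3 -/S2 in le3.
have S2E : S2 = M%:R * (L%:R * b%:R - b%:R ^+ 2) by rewrite mulrBr mulrA -e2; ring.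
have {}le3 : L%:R * (ST B)%:R <= b%:R ^+ 3 + l * (L%:R * b%:R - b%:R ^+ 2) :> int.
  have M0' : 0 < M%:R :> int by rewrite ltr0n.
  rewrite -(ler_pM2l M0') mulrA -e3 mulrDr lerD2l (le_trans le3) // S2E.
  by rewrite mulrCA.
have gap : 0 <= b%:R * ((b%:R - m%:R) * (L%:R - 2 * b%:R)) :> int.
  by rewrite mulr_ge0 ?mulr_ge0 ?subr_ge0 -?natrM ?ler_nat.
have L0 : 0 < L%:R :> int.
  by rewrite ltr0n; apply/card_gt0P; exists 0; apply/perpP => x _; rewrite dotr0.
rewrite -(ler_nat int) -(ler_pM2l L0) natrM (le_trans le3) // -subr_ge0.
apply: le_trans gap _; rewrite le_eqVlt; apply/orP; left; apply/eqP.
rewrite /l; ring.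
Qed.

(** Among x, y and x + y, either none or exactly two lie off the hyperplane. In
    the three mixed types the two entries off it determine the third. *)
Lemma ST_le_split n (B : {set 'rV['F_2]_n}) u :
  (ST B <= ST (B :&: perp [set u]) + 3 * #|B :\: perp [set u]| ^ 2)%N.
Proof.
set B0 := _ :&: _; set B1 := _ :\: _.
have sp Q R : schur B Q R = (schur B0 Q R + schur B1 Q R)%N by exact: schur_split.
have d0 x : x \in B0 -> dot u x = 0 by rewrite in_setI mem_perp1 => /andP[_ /eqP].
have d1 x : x \in B1 -> dot u x = 1.
  by rewrite in_setD mem_perp1 F2_neq0 => /andP[/eqP].
have z001 : schur B0 B0 B1 = 0%N.
  apply: schur_eq0 => x y /d0 x0 /d0 y0; apply/negP => /d1.
  by rewrite dotDr x0 y0.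
have z111 : schur B1 B1 B1 = 0%N.
  apply: schur_eq0 => x y /d1 x0 /d1 y0; apply/negP => /d1.
  by rewrite dotDr x0 y0.
have z010 : schur B0 B1 B0 = 0%N by rewrite schurC schur_rot.
have z100 : schur B1 B0 B0 = 0%N by rewrite schur_rot.
have s011 : schur B0 B1 B1 = schur B1 B1 B0 by exact: schur_rot.
have s101 : schur B1 B0 B1 = schur B0 B1 B1 by exact: schurC.
have lemax := schur_le B1 B1 B0.
have e00 : schur B0 B0 B = schur B0 B0 B0 by rewrite schur_rot sp z100 addn0.
have e10 : schur B1 B0 B = schur B1 B1 B0 by rewrite schur_rot sp z001 s101 s011.
have e11 : schur B1 B1 B = schur B1 B1 B0 by rewrite schur_rot sp z111 addn0 s011.
have e01 : schur B0 B1 B = schur B1 B1 B0 by rewrite schurC.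
rewrite !ST_schur sp (schurC B0 B) (schurC B1 B) !sp e00 e10 e11 e01.
lia.
Qed.

(** * The maximal number of Schur triples in a set of given size *)

Lemma leq_rearrange (p q r s : nat) : (p <= q)%N -> (r <= s)%N ->
  (p * s + q * r <= p * r + q * s)%N.
Proof. by move=> /subnKC <- /subnKC <-; lia. Qed.

Lemma ST_le_sq n (B : {set 'rV['F_2]_n}) : (ST B <= #|B| ^ 2)%N.
Proof. by rewrite ST_schur -mulnn; apply: schur_le. Qed.

(** Both endpoints 2 ^ j = 2 |B| and 2 ^ j = |B| are allowed, where the bound is
    just |B| ^ 2: the induction step needs j for the part of B in a hyperplane
    even if that part has exactly 2 ^ j / 2 elements. *)
Lemma ST_upper n (B : {set 'rV['F_2]_n}) (j : nat) :
    (2 ^ j <= 2 * #|B|)%N -> (#|B| <= 2 ^ j)%N ->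
  (ST B + 3 * #|B| * 2 ^ j <= (2 ^ j) ^ 2 + 3 * #|B| ^ 2)%N.
Proof.
have [b] := ubnP #|B|; elim: b B j => // b IH B j; rewrite ltnS => Bb lo hi.
have trivB := ST_le_sq B.
have [e|lo'] := eqVneq (2 ^ j)%N (2 * #|B|)%N.
  by rewrite e -!mulnn in trivB *; lia.
have {lo lo'} lo : (2 ^ j < 2 * #|B|)%N by rewrite ltn_neqAle lo' lo.
have [e|hi'] := eqVneq #|B| (2 ^ j)%N.
  by rewrite -e -!mulnn in trivB *; lia.
have {hi hi'} hi : (#|B| < 2 ^ j)%N by rewrite ltn_neqAle hi' hi.
set L := #|perp (perp B)|.
have BL : (#|B| <= L)%N by apply/subset_leq_card/sub_perp_perp.
have [l lE] : exists l, L = (2 ^ l)%N.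
  have : (L %| 2 ^ n)%N by rewrite -(card_perp B) dvdn_mull.
  by case/(dvdn_pfactor _ _ (isT : prime 2)) => l _ ->; exists l.
have [small|big] := ltnP L (2 * #|B|)%N.
  have -> : (2 ^ j = L)%N.
    rewrite lE in BL small *; congr (2 ^ _)%N; apply/eqP; rewrite eqn_leq.
    apply/andP; split; rewrite -ltnS -(ltn_exp2l _ _ (isT : 1 < 2)%N) expnS; lia.
  have C := ST_complement (@perpD n (perp B)) (sub_perp_perp B).
  have := cardsID B (perp (perp B)).
  rewrite (setIidPr (sub_perp_perp B)) -/L => LE.
  rewrite -LE -!mulnn in C *; lia.
(* Strictly between 2 ^ j / 2 and 2 ^ j there is an integer only for j >= 2. *)
case: j => [|[|i]] in lo hi *; rewrite ?expn0 ?expn1 in lo hi; try lia.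
rewrite !expnS in lo hi *; set Q := (2 ^ i)%N in lo hi *.
have [u0 Hu0] : exists u, u \notin perp B.
  apply/existsP; rewrite -negb_forall; apply/negP => /forallP all_perp.
  have perpBT : perp B = setT by apply/setP => u; rewrite all_perp inE.
  by rewrite /L perpBT perpT cards1 in big; lia.
pose m u := #|B :&: perp [set u]|.
case: (@arg_maxnP _ u0 (fun u => u \notin perp B) m Hu0) => u uB umax.
have split := ST_le_split B u.
have cardB := cardsID (perp [set u]) B.
set B0 := B :&: perp [set u] in split cardB.
set B1 := B :\: perp [set u] in split cardB.
have B1_gt0 : (0 < #|B1|)%N.
  rewrite card_gt0; apply: contraNneq uB => B10; apply/perpP => x Bx.
  have : x \notin B1 by rewrite B10 inE.
  by rewrite in_setD Bx andbT negbK => /perpP/(_ u (set11 u)); rewrite dotC.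
have [big0|small0] := leqP (2 * Q)%N #|B0|.
  have := IH B0 i.+2; rewrite !expnS -/Q => /(_ _ _ _) IH0.
  have {}IH0 := IH0 ltac:(lia) ltac:(lia) ltac:(lia).
  (* The slack in the inequality is 3 * |B1| * (2 * |B0| - 4 * Q). *)
  have := leq_mul (leqnn #|B1|) big0.
  rewrite -cardB -!mulnn in split IH0 *; lia.
have [small1|big1] := leqP #|B1| Q.
  have := IH B0 i.+1; rewrite !expnS -/Q => /(_ _ _ _) IH0.
  have {}IH0 := IH0 ltac:(lia) ltac:(lia) ltac:(lia).
  (* The slack in the inequality is 3 * (2 * Q - |B0|) * (2 * Q - 2 * |B1|). *)
  have := leq_rearrange (ltnW small0) (leq_mul (leqnn 2) small1).
  rewrite -cardB -!mulnn in split IH0 *; lia.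
have main : (ST B <= #|B| * #|B0|)%N.
  by apply: ST_le_max => //; rewrite -?cardB ?leq_addr.
have b0_le : (#|B0| + Q <= #|B|)%N by lia.
have := leq_mul (leqnn #|B|) b0_le.
(* The form 2 b^2 - 11 b Q + 16 Q^2 is ((4 b - 11 Q)^2 + 7 Q^2) / 8. *)
have [+ _] := nat_Cauchy (4 * #|B|) (11 * Q).
rewrite -!mulnn; lia.
Qed.

(** * Binary digits and the top set *)

Lemma card_cube_setC n (A : {set 'rV['F_2]_n}) : #|~: A| = (2 ^ n - #|A|)%N.
Proof. by rewrite cardsCs setCK card_mx card_Fp // mul1n. Qed.

Lemma eq_digits n m1 m2 : (m1 < 2 ^ n)%N -> (m2 < 2 ^ n)%N ->
    (forall j, (j < n)%N -> odd (m1 %/ 2 ^ j) = odd (m2 %/ 2 ^ j)) ->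
  m1 = m2.
Proof.
elim: n m1 m2 => [|n IH] m1 m2; first by rewrite expn0; lia.
rewrite expnS => lt1 lt2 bits.
have := bits 0%N isT; rewrite expn0 !divn1 => b0.
rewrite -(odd_double_half m1) -(odd_double_half m2) b0 -!divn2.
congr (_ + _.*2)%N; apply: IH => [||j jn]; try by rewrite ltn_divLR // mulnC.
by have := bits j.+1 jn; rewrite expnS !divnMA.
Qed.

Lemma binary_vector_digit n m (i : 'I_n) :
  (binary_vector n m 0 i == 1) = odd (m %/ 2 ^ (n - i.+1)).
Proof. by rewrite mxE; case: odd. Qed.

Lemma binary_vector_inj n m1 m2 : (m1 < 2 ^ n)%N -> (m2 < 2 ^ n)%N ->
  binary_vector n m1 = binary_vector n m2 -> m1 = m2.
Proof.
move=> lt1 lt2 e; apply: (eq_digits lt1 lt2) => j jn.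
have lt : (n - j.+1 < n)%N by lia.
have -> : j = (n - (Ordinal lt).+1)%N by rewrite /=; lia.
by rewrite -!binary_vector_digit e.
Qed.

(** Injectivity on the numbers below 2 ^ n gives surjectivity by counting. *)
Lemma binary_vectorP n (x : 'rV['F_2]_n) :
  exists2 m, (m < 2 ^ n)%N & x = binary_vector n m.
Proof.
pose f (m : 'I_(2 ^ n)) := binary_vector n m.
have finj : injective f by move=> m1 m2 /binary_vector_inj e; apply/val_inj/e.
have : x \in codom f.
  by rewrite (inj_card_onto finj) // card_mx card_Fp // card_ord mul1n.
by case/codomP => m ->; exists m.
Qed.

Lemma mem_top_set n a m : (a <= 2 ^ n)%N -> (m < 2 ^ n)%N ->
  (binary_vector n m \in top_set n a) = (2 ^ n - a <= m)%N.
Proof.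
move=> an mn; apply/imsetP/idP => [[j _ e]|le].
  have ja := ltn_ord j.
  have -> : m = (2 ^ n - j.+1)%N by apply: (binary_vector_inj mn _ e); lia.
  by lia.
have lt : (2 ^ n - m.+1 < a)%N by lia.
by exists (Ordinal lt) => //=; congr binary_vector; lia.
Qed.

Lemma card_top_set n a : (a <= 2 ^ n)%N -> #|top_set n a| = a.
Proof.
move=> an; rewrite card_imset ?card_ord // => i j e; apply/val_inj => /=.
have ia := ltn_ord i; have ja := ltn_ord j.
suff : (2 ^ n - i.+1 = 2 ^ n - j.+1)%N by lia.
by apply: (binary_vector_inj _ _ e); lia.
Qed.

(** Coordinate i is the digit of weight 2 ^ (n - 1 - i), so these are the vectors
    whose digits of weight at least 2 ^ k vanish. *)
Definition low_space n k : {set 'rV['F_2]_n} :=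
  [set x : 'rV['F_2]_n | [forall i : 'I_n, (k + i < n)%N ==> (x 0 i == 0)]].

Lemma low_spaceD n k (x y : 'rV['F_2]_n) :
  x \in low_space n k -> y \in low_space n k -> x + y \in low_space n k.
Proof.
rewrite !inE => /forallP hx /forallP hy; apply/forallP => i; apply/implyP => ki.
by rewrite mxE (eqP (implyP (hx i) ki)) (eqP (implyP (hy i) ki)) addr0.
Qed.

Lemma mem_low_space n k m : (k <= n)%N -> (m < 2 ^ n)%N ->
  (binary_vector n m \in low_space n k) = (m < 2 ^ k)%N.
Proof.
move=> kn mn; rewrite inE; apply/forallP/idP => [h|mk i]; last first.
  apply/implyP => ki; rewrite mxE divn_small //.
  by rewrite (leq_trans mk) // leq_exp2l //; lia.
suff m0 : (m %/ 2 ^ k = 0)%N by rewrite ltnNge -divn_gt0 ?expn_gt0 // m0.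
apply: (@eq_digits (n - k)); rewrite ?expn_gt0 //.
  by rewrite ltn_divLR ?expn_gt0 // -expnD subnK.
move=> j jnk; rewrite -divnMA -expnD div0n /=.
have lt : (n - (k + j).+1 < n)%N by lia.
have e : (k + j = n - (Ordinal lt).+1)%N by rewrite /=; lia.
have := implyP (h (Ordinal lt)) ltac:(rewrite /=; lia).
by rewrite mxE -e; case: odd.
Qed.

Lemma low_spaceE n k : (k <= n)%N -> low_space n k = ~: top_set n (2 ^ n - 2 ^ k).
Proof.
move=> kn; have kn2 : (2 ^ k <= 2 ^ n)%N by rewrite leq_exp2l.
apply/setP => x; have [m mn ->] := binary_vectorP x.
by rewrite in_setC mem_low_space // mem_top_set ?leq_subr // subKn // -ltnNge.
Qed.

Lemma card_setC_top_set n a : (a <= 2 ^ n)%N -> #|~: top_set n a| = (2 ^ n - a)%N.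
Proof.
by move=> an; rewrite card_cube_setC card_top_set.
Qed.

(** The complement of the top set consists of the numbers below b = 2 ^ n - a.
    The numbers in [b, 2 ^ k) exceed 2 ^ k / 2, so they all have digit k - 1
    equal to 1 and no two of them have their sum among them. *)
Lemma ST_setC_top_set n a k : (k <= n)%N -> (a < 2 ^ n)%N ->
    (2 ^ k < 2 * (2 ^ n - a))%N -> (2 ^ n - a <= 2 ^ k)%N ->
  (ST (~: top_set n a) + 3 * (2 ^ n - a) * 2 ^ k =
   (2 ^ k) ^ 2 + 3 * (2 ^ n - a) ^ 2)%N.
Proof.
move=> kn an lo hi; have an' := ltnW an.
have kn2 : (2 ^ k <= 2 ^ n)%N by rewrite leq_exp2l.
set S := low_space n k; set B := ~: top_set n a.
have cardS : #|S| = (2 ^ k)%N by rewrite /S low_spaceE // card_setC_top_set; lia.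
have cardB : #|B| = (2 ^ n - a)%N by rewrite card_setC_top_set.
have BS : B \subset S.
  apply/subsetP => x; have [m mn ->] := binary_vectorP x.
  by rewrite in_setC mem_top_set // mem_low_space //; lia.
have C0 : ST (S :\: B) = 0%N.
  have top1 (x : 'rV['F_2]_n) : x \in S :\: B ->
      exists2 i : 'I_n, i = (n - k)%N :> nat & x 0 i = 1.
    have [m mn ->] := binary_vectorP x.
    rewrite in_setD in_setC mem_top_set // mem_low_space // negbK => /andP[bm mk].
    case: k kn lo hi mk {kn2 S cardS BS} => [|k] kn lo hi mk; first by lia.
    have lt : (n - k.+1 < n)%N by lia.
    exists (Ordinal lt) => //; apply/eqP; rewrite binary_vector_digit /=.
    have -> : (n - (n - k.+1).+1 = k)%N by lia.
    rewrite expnS in lo mk.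
    suff -> : (m %/ 2 ^ k = 1)%N by [].
    by apply/eqP; rewrite eqn_leq -ltnS ltn_divLR ?leq_divRL ?expn_gt0 //; lia.
  rewrite ST_schur; apply: schur_eq0 => x y /top1[i iE x1] /top1[j jE y1].
  apply/negP => /top1[l lE]; rewrite mxE.
  have -> : l = i by apply/val_inj; rewrite /= lE iE.
  have ij : i = j by apply/val_inj; rewrite /= jE iE.
  by rewrite x1 ij y1.
have := ST_complement (@low_spaceD n k) BS.
have := cardsID B S; rewrite (setIidPr BS) cardS cardB C0 => e.
rewrite -/S -e -!mulnn; lia.
Qed.

(** * The extremal problem *)

(** Over the integers nothing forces k >= 0 beforehand; two admissible exponents
    k and l satisfy k - 1 < l and l - 1 < k by comparing powers of 2. *)
Lemma unique_dyadic_scale n a k : (a < 2 ^ n)%N ->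
    (2 ^ k < 2 * (2 ^ n - a))%N -> (2 ^ n - a <= 2 ^ k)%N ->
  unique (fun k : int =>
      ((2 : rat) ^+ n - (2 : rat) ^ k <= a%:R
         < (2 : rat) ^+ n - (2 : rat) ^ (k - 1)) : Prop) k.
Proof.
move=> an lo hi; set b := (2 ^ n - a)%N in lo hi.
have nE : (2 : rat) ^+ n = a%:R + b%:R by rewrite -natrD subnKC ?natrX // ltnW.
have two1 : 1 < 2 :> rat by [].
have condE (l : int) : ((2 : rat) ^+ n - 2 ^ l <= a%:R < (2 : rat) ^+ n - 2 ^ (l - 1))
    = ((2 : rat) ^ (l - 1) < b%:R <= (2 : rat) ^ l).
  by rewrite nE andbC; congr andb; apply/idP/idP; lra.
have kP : (2 : rat) ^ (k%:Z - 1) < b%:R <= (2 : rat) ^ k%:Z.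
  rewrite -exprnP -natrX ler_nat hi andbT.
  rewrite expfzDr // -exprnP -natrX ltr_pdivrMr // -natrM ltr_nat.
  by rewrite mulnC.
split; first by rewrite /= condE.
move=> l; rewrite condE => /andP[lo' hi']; have /andP[lo'' hi''] := kP.
have := lt_le_trans lo' hi''; have := lt_le_trans lo'' hi'.
by rewrite !ltr_eXz2l //; lia.
Qed.

Theorem theorem1p5 (n a : nat) (hn : (0 < n)%N)
    (ha : (1 <= a <= 2 ^ n - 1)%N) :
  exists k : int,
    unique (fun k : int =>
      ((2 : rat) ^+ n - (2 : rat) ^ k <= a%:R
         < (2 : rat) ^+ n - (2 : rat) ^ (k - 1)) : Prop) k /\
    (forall A : {set 'rV['F_2]_n}, #|A| = a ->
       (ST (top_set n a) <= ST A)%N) /\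
    (ST (top_set n a))%:R =
      (3 * a%:R + (2 : rat) ^ k - (2 : rat) ^+ n.+1)
      * ((2 : rat) ^+ n - (2 : rat) ^ k).
Proof.
have /andP[a_gt0 a_le] := ha.
have an : (a < 2 ^ n)%N by lia.
have [k [kn lo hi]] : exists k, [/\ (k <= n)%N, (2 ^ k < 2 * (2 ^ n - a))%N
    & (2 ^ n - a <= 2 ^ k)%N].
  have [b1|b1] := leqP (2 ^ n - a) 1; first by exists 0%N; rewrite expn0; split; lia.
  have /= := up_log_bounds (isT : 1 < 2)%N b1.
  case: up_log => [|k] /andP[lo hi]; first by rewrite expn0 in hi; lia.
  rewrite /= in lo; exists k.+1; split=> //; last by rewrite expnS ltn_mul2l.
  by rewrite -(ltn_exp2l _ _ (isT : 1 < 2)%N); lia.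
have dual (A : {set 'rV['F_2]_n}) : #|A| = a ->
    (ST A + ST (~: A) + a * (2 ^ n - a) = a ^ 2 + (2 ^ n - a) ^ 2)%N.
  move=> cA; have := @ST_complement n setT A (fun _ _ _ _ => in_setT _) (subsetT A).
  by rewrite setTD card_cube_setC cA.
have topE := ST_setC_top_set kn an lo hi.
have topD := dual _ (card_top_set (ltnW an)).
exists k; split; first exact: unique_dyadic_scale; split.
  move=> A cA; have := dual A cA; have := @ST_upper n (~: A) k.
  rewrite card_cube_setC cA => /(_ (ltnW lo) hi).
  lia.
have nE : (2 : rat) ^+ n = a%:R + (2 ^ n - a)%:R.
  by rewrite -natrD subnKC ?natrX // ltnW.
rewrite -exprnP exprS nE -natrX.
move: topE topD => /(congr1 (fun m => m%:R : rat)) topE.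
move=> /(congr1 (fun m => m%:R : rat)) topD.
rewrite !(natrD, natrM, natrX) in topE topD *.
lra.
Qed.
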